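(* Suppose there existed a knot $K\subset S^3$ whose knot Floer complex over $\mathbb{F}[U,V]$ was given by the free complex on generators $a,b,c,d,e$ with $$\partial b=U^3a+V^3c,\qquad \partial a=V^3 d,\qquad \partial c=U^3 d,\qquad \partial e=UV\,d,\qquad \partial d=0.$$ Then $\Upsilon_K(t)$ is nontrivial (not identically zero on $[0,2]$), while $\varphi_j(K)=0$ for all $j\in\mathbb{N}$.
   Context: Conventions: $\mathbb{F}=\mathbb{Z}/2\mathbb{Z}$, $\mathbb{N}=\{1,2,3,\dots\}$. The ring $\mathbb{F}[U,V]$ and its quotient $\mathcal{R}=\mathbb{F}[U,V]/(UV)$ have bigrading $\mathrm{gr}=(\mathrm{gr}_U,\mathrm{gr}_V)$, $\mathrm{gr}(U)=(-2,0)$, $\mathrm{gr}(V)=(0,-2)$. (The complex of the statement is drawn in the paper as a planar picture with generators $a$ at $(0,3)$, $b$ at $(3,3)$, $c$ at $(3,0)$, $d$ at $(0,0)$, $e$ at $(1,1)$ and arrows $b\to a$, $b\to c$, $c\to d$, $a\to d$, $e\to d$; an arrow with horizontal length $p$ and vertical length $q$ carries the coefficient $U^pV^q$. It has gradings $\mathrm{gr}(e)=(0,0)$, $\mathrm{gr}(d)=(1,1)$, $\mathrm{gr}(a)=(2,-4)$, $\mathrm{gr}(c)=(-4,2)$, $\mathrm{gr}(b)=(-3,-3)$.) Knot-like complexes. A knot-like complex $C$ is a free, finitely generated, bigraded chain complex over $\mathcal{R}$, with differential of degree $(-1,-1)$, such that (1) $H_*(C/U)/V\text{-torsion}\cong\mathbb{F}[V]$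 and all $V$-nontorsion classes in $H_*(C/U)$ have $\mathrm{gr}_U=0$; (2) $H_*(C/V)/U\text{-torsion}\cong\mathbb{F}[U]$ and all $U$-nontorsion classes in $H_*(C/V)$ have $\mathrm{gr}_V=0$. Write $C_1\le C_2$ if there is a local map $f\colon C_1\to C_2$, i.e. an $\mathcal{R}$-equivariant chain map that preserves $\mathrm{gr}_U$, shifts $\mathrm{gr}_V$ by a constant, and induces an isomorphism $H_*(C_1/U)/V\text{-torsion}\to H_*(C_2/U)/V\text{-torsion}$. $C_1$ and $C_2$ are locally equivalent, $C_1\sim C_2$, if $C_1\le C_2$ and $C_2\le C_1$. Standard complexes. For $n\ge 0$ even and nonzero integers $b_1,\dots,b_n$, the standard complex $C(b_1,\dots,b_n)$ is freely generated over $\mathcal{R}$ by $x_0,\dots,x_n$ with $\partial=\partial_U+\partial_V$, where for $i$ odd: $\partial_U x_{i-1}=U^{|b_i|}x_i$ if $b_i<0$, and $\partial_U x_i=U^{b_i}x_{i-1}$ if $b_i>0$; for $i$ even: $\partial_V x_{i-1}=V^{|b_i|}x_i$ if $b_i<0$, and $\partial_V x_i=V^{b_i}x_{i-1}$ if $b_i>0$; all other $\partial_U,\partial_V$ of generators vanish. The bigrading is the unique one with $\mathrm{gr}_U(x_0)=0$, $\mathrm{gr}_V(x_n)=0$ and $\partial$ of degree $(-1,-1)$. For $n=0$ this is the trivial complex $C(0)=\mathcal{R}$. Knot Floer complex. For a knot $K\subset S^3$ with doubly-pointed Heegaard diagram $(\Sigma,\alpha,\beta,w,z)$, $CFK_{\mathbb{F}[U,V]}(K)$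 is freely generated over $\mathbb{F}[U,V]$ by $\mathbf{x}\in\mathbb{T}_\alpha\cap\mathbb{T}_\beta$ with $\partial\mathbf{x}=\sum_{\mathbf{y}}\sum_{\phi\in\pi_2(\mathbf{x},\mathbf{y}),\,\mu(\phi)=1}U^{n_w(\phi)}V^{n_z(\phi)}\mathbf{y}$ (with the usual count of holomorphic representatives mod 2), relative gradings $\mathrm{gr}_U(\mathbf{x},\mathbf{y})=\mu(\phi)-2n_w(\phi)$, $\mathrm{gr}_V(\mathbf{x},\mathbf{y})=\mu(\phi)-2n_z(\phi)$, and is well defined up to homotopy equivalence; $CFK_{\mathcal{R}}(K)$ is its reduction modulo $UV$, and the absolute gradings are normalized so that $CFK_{\mathcal{R}}(K)$ is a knot-like complex. Definition of $\varphi_j$. Every knot-like complex is locally equivalent to a unique standard complex, its standard complex representative. If $C(a_1,\dots,a_n)$ is the standard complex representative of $CFK_{\mathcal{R}}(K)$, then for $j\in\mathbb{N}$ $$\varphi_j(K)=\#\{i \text{ odd}: a_i=j\}-\#\{i\text{ odd}: a_i=-j\}.$$ $\Upsilon_K(t)$, $t\in[0,2]$, is the Ozsváth–Stipsicz–Szabó invariant: substitute $U=v^{2-t}$, $V=v^t$ in $CFK_{\mathbb{F}[U,V]}(K)$ (so coefficients are finite sums of powers $v^\alpha$, $\alpha\in\mathbb{R}_{\ge0}$), with grading $\mathrm{gr}_t=(1-\tfrac t2)\mathrm{gr}_U+\tfrac t2\mathrm{gr}_V$, in which $v$ has degree $-1$; $\Upsilon_K(t)$ is the maximal $\mathrm{gr}_t$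 of a homogeneous homology class not annihilated by any power of $v$. *)

(* Defs.v *)
From HB Require Import structures.
From mathcomp Require Import all_boot all_order all_algebra ring_quotient.
From mathcomp Require Import boolp reals.
From mathcomp.multinomials Require Import monalg.
From mathcomp Require Import zify.

Set Implicit Arguments.
Unset Strict Implicit.
Unset Printing Implicit Defensive.

Import Order.TTheory GRing.Theory Num.Theory.

Local Open Scope ring_scope.
Local Open Scope quotient_scope.

(* F[U,V] is F[U][V]: the inner variable is U, the outer variable is V, so   *)
(* p`_n`_m is the coefficient of U^m V^n in p.                               *)
Definition FUV : comNzRingType := {poly {poly 'F_2}}.
Definition varU : FUV := 'X%:P.
Definition varV : FUV := 'X.

(* gr(U) = (-2, 0) and gr(V) = (0, -2); 0 is homogeneous of every bidegree.  *)
Definition homFUV (u v : int) (p : FUV) : Prop :=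
  forall m n : nat, (p : {poly {poly 'F_2}})`_n`_m != 0 ->
    u = - (2 * m)%:Z /\ v = - (2 * n)%:Z.

Lemma homFUV_mono (u v : int) (m n : nat) : u = - (2 * m)%:Z -> v = - (2 * n)%:Z ->
  homFUV u v (varU ^+ m * varV ^+ n).
Proof.
move=> -> -> m' n'; rewrite /varU /varV -rmorphXn coefCM coefXn.
case: (eqVneq n' n) => [->|_]; last by rewrite mulr0 coef0 eqxx.
by rewrite mulr1 coefXn; case: (eqVneq m' m) => [->|_] //; rewrite eqxx.
Qed.

Lemma homFUV_U (u v : int) (m : nat) : u = - (2 * m)%:Z -> v = 0 ->
  homFUV u v (varU ^+ m).
Proof. by move=> hu hv; rewrite -[_ ^+ m]mulr1; apply: (@homFUV_mono _ _ m 0). Qed.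

Lemma homFUV_V (u v : int) (n : nat) : u = 0 -> v = - (2 * n)%:Z ->
  homFUV u v (varV ^+ n).
Proof. by move=> hu hv; rewrite -[_ ^+ n]mul1r; apply: (@homFUV_mono _ _ 0 n). Qed.

Lemma homFUV0 u v : homFUV u v 0.
Proof. by move=> m n; rewrite !coef0 eqxx. Qed.

(* U |-> a, V |-> b *)
Definition substUV (S : comAlgType 'F_2) (a b : S) (p : FUV) : S :=
  (map_poly (horner_alg a) p).[b].

Definition modU : FUV -> {poly 'F_2} := substUV 0 'X.
Definition modV : FUV -> {poly 'F_2} := substUV 'X 0.

Section Subst.
Variables (S : comAlgType 'F_2) (a b : S).

Fact substUV_is_zmod_morphism : zmod_morphism (substUV a b).
Proof. by move=> p q; rewrite /substUV rmorphB hornerD hornerN. Qed.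

Fact substUV_is_monoid_morphism : monoid_morphism (substUV a b).
Proof.
split=> [|p q]; first by rewrite /substUV rmorph1 hornerC.
by rewrite /substUV rmorphM hornerM.
Qed.

HB.instance Definition _ :=
  GRing.isZmodMorphism.Build FUV S (substUV a b) substUV_is_zmod_morphism.
HB.instance Definition _ :=
  GRing.isMonoidMorphism.Build FUV S (substUV a b) substUV_is_monoid_morphism.

Lemma substUV_U : substUV a b varU = a.
Proof. by rewrite /substUV /varU map_polyC hornerC /= horner_algX. Qed.

Lemma substUV_V : substUV a b varV = b.
Proof. by rewrite /substUV /varV map_polyX hornerX. Qed.
End Subst.

HB.instance Definition _ := GRing.RMorphism.on modU.
HB.instance Definition _ := GRing.RMorphism.on modV.

Definition idealUV : {pred FUV} :=
  fun p => `[< exists q : FUV, p = q * (varU * varV) >].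

Lemma idealUV_modU p : p \in idealUV -> modU p = 0.
Proof.
by move=> /asboolP[q ->]; rewrite !rmorphM /= [modU varU]substUV_U mul0r mulr0.
Qed.

Lemma idealUV_modV p : p \in idealUV -> modV p = 0.
Proof.
by move=> /asboolP[q ->]; rewrite !rmorphM /= [modV varV]substUV_V !mulr0.
Qed.

Fact idealUV_closed : idealr_closed idealUV.
Proof.
split.
- by apply/asboolP; exists 0; rewrite mul0r.
- apply/negP => /idealUV_modU; rewrite rmorph1; exact/eqP/oner_neq0.
- move=> a u v /asboolP[p ->] /asboolP[q ->].
  by apply/asboolP; exists (a * p + q);
  rewrite mulrDl -[in RHS]mulrA.
Qed.

HB.instance Definition _ := isIdealr.Build FUV idealUV idealUV_closed.

Definition RUV : comNzRingType := {ideal_quot idealUV}.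
Definition piR (p : FUV) : RUV := \pi_{ideal_quot idealUV} p.

Fact piR_is_zmod_morphism : zmod_morphism piR.
Proof. exact: (rmorphB \pi_{ideal_quot idealUV}). Qed.

Fact piR_is_monoid_morphism : monoid_morphism piR.
Proof.
split; first exact: (rmorph1 \pi_{ideal_quot idealUV}).
exact: (rmorphM \pi_{ideal_quot idealUV}).
Qed.

HB.instance Definition _ :=
  GRing.isZmodMorphism.Build FUV RUV piR piR_is_zmod_morphism.
HB.instance Definition _ :=
  GRing.isMonoidMorphism.Build FUV RUV piR piR_is_monoid_morphism.

Definition homR (u v : int) (r : RUV) : Prop :=
  exists2 p : FUV, homFUV u v p & r = piR p.

Definition liftR (r : RUV) : FUV := repr (r : {ideal_quot idealUV}).

Lemma liftRK : cancel liftR piR.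
Proof. exact: reprK. Qed.

Lemma piR_eq (p q : FUV) : (piR p == piR q) = (p - q \in idealUV).
Proof. by rewrite Quotient.idealrBE. Qed.

(* The quotient maps RUV -> RUV/U = F[V] and RUV -> RUV/V = F[U].            *)
Definition RmodU (r : RUV) : {poly 'F_2} := modU (liftR r).
Definition RmodV (r : RUV) : {poly 'F_2} := modV (liftR r).

Lemma RmodU_pi p : RmodU (piR p) = modU p.
Proof.
apply/eqP; rewrite -subr_eq0 -rmorphB; apply/eqP/idealUV_modU.
by rewrite -piR_eq liftRK.
Qed.

Lemma RmodV_pi p : RmodV (piR p) = modV p.
Proof.
apply/eqP; rewrite -subr_eq0 -rmorphB; apply/eqP/idealUV_modV.
by rewrite -piR_eq liftRK.
Qed.

(* A free, finitely generated, bigraded chain complex over S, with respect   *)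
(* to a homogeneous basis indexed by 'I_(rk C). Chains are row vectors, so   *)
(* row i of diff is the differential of the i-th basis element, the          *)
(* differential is x |-> x *m diff, and a chain map C1 -> C2 is a matrix f   *)
(* with diff C1 *m f = f *m diff C2. hom u v expresses homogeneity           *)
(* of bidegree (u, v) in the coefficient ring.                               *)
Record complex (S : comNzRingType) (hom : int -> int -> S -> Prop) := Complex {
  rk : nat;
  grU : 'I_rk -> int;
  grV : 'I_rk -> int;
  diff : 'M[S]_rk;
  diff_homog : forall i j,
    hom (grU i - 1 - grU j) (grV i - 1 - grV j) (diff i j);
  diff_sq : diff *m diff = 0
}.

Notation cxFUV := (complex homFUV).
Notation cxR := (complex homR).

Section Maps.
Variables (S : comNzRingType) (hom : int -> int -> S -> Prop).
Implicit Types C : complex hom.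

Definition homog_map C1 C2 (u v : int) (f : 'M[S]_(rk C1, rk C2)) : Prop :=
  forall i j, hom (grU i + u - grU j) (grV i + v - grV j) (f i j).

Definition chain_map C1 C2 (f : 'M[S]_(rk C1, rk C2)) : Prop :=
  diff C1 *m f = f *m diff C2.

Definition homotopic_id C (f : 'M[S]_(rk C)) : Prop :=
  exists2 h : 'M[S]_(rk C), @homog_map C C 1 1 h &
    f - 1%:M = diff C *m h + h *m diff C.

Definition homotopy_equivalent C1 C2 : Prop :=
  exists (f : 'M[S]_(rk C1, rk C2)) (g : 'M[S]_(rk C2, rk C1)),
    [/\ @homog_map C1 C2 0 0 f /\ @chain_map C1 C2 f,
        @homog_map C2 C1 0 0 g /\ @chain_map C2 C1 g,
        @homotopic_id C1 (f *m g) & @homotopic_id C2 (g *m f)].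
End Maps.

Section ModUV.
Variable C : cxFUV.

Definition modUV_diff : 'M[RUV]_(rk C) := map_mx piR (diff C).

Fact modUV_homog i j :
  homR (grU i - 1 - grU j) (grV i - 1 - grV j) (modUV_diff i j).
Proof. by rewrite mxE; exists (diff C i j) => //; apply: diff_homog. Qed.

Fact modUV_sq : modUV_diff *m modUV_diff = 0.
Proof. by rewrite -map_mxM diff_sq map_mx0. Qed.

Definition modUV : cxR := Complex modUV_homog modUV_sq.
End ModUV.

Section Homology.
Variables (S : comNzRingType) (n : nat) (d : 'M[S]_n).

Definition is_cycle (x : 'rV[S]_n) : Prop := x *m d = 0.
Definition is_boundary (x : 'rV[S]_n) : Prop := exists y, x = y *m d.
End Homology.

Section Tower.
Variables (n : nat) (d : 'M[{poly 'F_2}]_n).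

Definition is_torsion (x : 'rV[{poly 'F_2}]_n) : Prop :=
  exists k : nat, is_boundary d ('X^k *: x).

(* H(d)/torsion is isomorphic to F[X]: some F[X]-linear map from the cycles  *)
(* onto F[X] has as kernel the cycles with torsion homology class.           *)
Definition is_tower : Prop :=
  exists g : 'rV[{poly 'F_2}]_n -> {poly 'F_2},
    [/\ forall (a : {poly 'F_2}) x y, is_cycle d x -> is_cycle d y ->
          g (a *: x + y) = a * g x + g y,
        forall x, is_cycle d x -> (g x = 0 <-> is_torsion x)
      & forall p, exists2 x, is_cycle d x & g x = p].

(* deg is the grading that multiplication by X preserves.                    *)
Definition nontorsion_in_degree0 (deg : 'I_n -> int) : Prop :=
  forall (s : int) (x : 'rV[{poly 'F_2}]_n),
    (forall i, x 0 i != 0 -> deg i = s) ->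
    is_cycle d x -> ~ is_torsion x -> s = 0.
End Tower.

Definition diffmodU (C : cxR) : 'M[{poly 'F_2}]_(rk C) := map_mx RmodU (diff C).
Definition diffmodV (C : cxR) : 'M[{poly 'F_2}]_(rk C) := map_mx RmodV (diff C).

Definition knot_like (C : cxR) : Prop :=
  [/\ is_tower (diffmodU C), nontorsion_in_degree0 (diffmodU C) (@grU _ _ C),
      is_tower (diffmodV C) & nontorsion_in_degree0 (diffmodV C) (@grV _ _ C)].

Section Local.
Variables C1 C2 : cxR.

(* f induces an isomorphism H(C1/U)/V-torsion -> H(C2/U)/V-torsion.          *)
Definition tower_iso (f : 'M[RUV]_(rk C1, rk C2)) : Prop :=
  let fU := map_mx RmodU f in
  (forall x, is_cycle (diffmodU C1) x ->
     is_torsion (diffmodU C2) (x *m fU) -> is_torsion (diffmodU C1) x) /\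
  (forall y, is_cycle (diffmodU C2) y ->
     exists2 x, is_cycle (diffmodU C1) x &
       is_torsion (diffmodU C2) (x *m fU - y)).

Definition local_map (f : 'M[RUV]_(rk C1, rk C2)) : Prop :=
  [/\ chain_map f, exists v : int, homog_map 0 v f & tower_iso f].

Definition local_le : Prop := exists f, local_map f.
End Local.

Definition locally_equivalent (C1 C2 : cxR) : Prop :=
  local_le C1 C2 /\ local_le C2 C1.

(* The standard complex C(b_1,...,b_n); b_(k+1) is b`_k, so the edge between *)
(* x_k and x_(k+1) carries a power of U for k even and of V for k odd.       *)
Definition std_var (k : nat) : RUV := piR (if odd k then varV else varU).

Lemma piR_UV : piR varU * piR varV = 0.
Proof.
rewrite -rmorphM; apply/eqP. rewrite -[X in _ == X](rmorph0 piR) piR_eq subr0.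
by apply/asboolP; exists 1; rewrite mul1r.
Qed.

Lemma std_var_mul k p q : (0 < p)%N -> (0 < q)%N ->
  std_var k ^+ p * std_var k.+1 ^+ q = 0.
Proof.
case: p => // p; case: q => // q _ _; rewrite exprSr exprS mulrA -[X in X * _]mulrA.
rewrite /std_var /=; case: (odd k); rewrite /= 1?[piR varV * _]mulrC piR_UV;
by rewrite mulr0 mul0r.
Qed.

Lemma std_var_homog k p u v :
  u = (if odd k then 0 else - (2 * p)%:Z) -> v = (if odd k then - (2 * p)%:Z else 0) ->
  homR u v (std_var k ^+ p).
Proof.
move=> -> ->; rewrite /std_var; case: (odd k); rewrite /= -rmorphXn.
  by exists (varV ^+ p) => //; apply: homFUV_V.
by exists (varU ^+ p) => //; apply: homFUV_U.
Qed.

Section Standard.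
Variable b : seq int.
Let n := size b.

Definition std_diff : 'M[RUV]_n.+1 :=
  \matrix_(i, j)
    if (j == i.+1 :> nat) && (b`_i < 0) then std_var i ^+ absz b`_i
    else if (i == j.+1 :> nat) && (0 < b`_j) then std_var j ^+ absz b`_j
    else 0.

(* Since the differential has bidegree (-1,-1), going from x_k to x_(k+1)    *)
(* changes both gradings by sgz b`_k, minus a further 2 b`_k in gr_U (k      *)
(* even) or gr_V (k odd); the normalization is gr_U x_0 = gr_V x_n = 0.      *)
Definition std_grU (i : 'I_n.+1) : int :=
  \sum_(0 <= k < i) (sgz b`_k - (if odd k then 0 else 2 * b`_k)).
Definition std_grV (i : 'I_n.+1) : int :=
  - \sum_(i <= k < n) (sgz b`_k - (if odd k then 2 * b`_k else 0)).

Fact std_homog i j :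
  homR (std_grU i - 1 - std_grU j) (std_grV i - 1 - std_grV j) (std_diff i j).
Proof.
have stepU (k l : 'I_n.+1) : l = k.+1 :> nat ->
    std_grU l = std_grU k + (sgz b`_k - (if odd k then 0 else 2 * b`_k)).
  by move=> lk; rewrite /std_grU lk big_nat_recr.
have stepV (k l : 'I_n.+1) : l = k.+1 :> nat ->
    std_grV l = std_grV k + (sgz b`_k - (if odd k then 2 * b`_k else 0)).
  move=> lk; rewrite /std_grV lk [X in _ = - X + _]big_ltn; last first.
    by rewrite -ltnS -lk ltn_ord.
  by rewrite opprD addrAC addNr add0r.
rewrite mxE; case: ifP => [/andP[/eqP ji bi]|_].
  rewrite (stepU _ _ ji) (stepV _ _ ji) ltr0_sgz//.
  by apply: std_var_homog; case: (odd i); lia.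
case: ifP => [/andP[/eqP ij bj]|_].
  rewrite (stepU _ _ ij) (stepV _ _ ij) gtr0_sgz//.
  by apply: std_var_homog; case: (odd j); lia.
by exists 0; [exact: homFUV0|rewrite rmorph0].
Qed.

Fact std_sq : std_diff *m std_diff = 0.
Proof.
apply/matrixP => i j; rewrite !mxE big1 // => k _; rewrite !mxE.
case: ifP => [/andP[/eqP ki bi]|_].
  case: ifP => [/andP[/eqP jk bk]|_].
    by rewrite ki std_var_mul //; rewrite ?ki in bk *; lia.
  case: ifP => [/andP[/eqP kj bj]|_]; last by rewrite mulr0.
  have ij : i = j :> nat by lia.
  by move: bi bj; rewrite ij; lia.
case: ifP => [/andP[/eqP ik bk]|_]; last by rewrite mul0r.
case: ifP => [/andP[/eqP jk bk']|_]; first by lia.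
case: ifP => [/andP[/eqP kj bj]|_]; last by rewrite mulr0.
by rewrite mulrC kj std_var_mul //; rewrite ?kj in bk *; lia.
Qed.

Definition std_complex : cxR := Complex std_homog std_sq.
End Standard.

Definition standard_seq (b : seq int) : bool :=
  ~~ odd (size b) && all (fun x => x != 0) b.

Definition standard_representative (C : cxR) (b : seq int) : Prop :=
  standard_seq b /\ locally_equivalent C (std_complex b).

(* a_i with i odd is a`_k with k even.                                       *)
Definition odd_count (a : seq int) (x : int) : nat :=
  #|[set k : 'I_(size a) | ~~ odd k & a`_k == x]|.

(* phi_j(C) = z. A standard representative of C is required to exist and to  *)
(* be unique, so that phi_eq C j is functional and carries no default value. *)
Definition phi_eq (C : cxR) (j : nat) (z : int) : Prop :=
  exists2 a, unique (standard_representative C) a &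
    z = (odd_count a j%:Z)%:Z - (odd_count a (- j%:Z))%:Z.

Section NonnegExponents.
Variable R : realType.

Record vexp := VExp { vexp_val :> R; vexp_ge0 : 0 <= vexp_val }.
HB.instance Definition _ := [isSub for vexp_val].
HB.instance Definition _ := [Choice of vexp by <:].

Definition vexp0 : vexp := VExp (lexx 0).
Definition vexpD (a b : vexp) : vexp := VExp (addr_ge0 (vexp_ge0 a) (vexp_ge0 b)).

Fact vexpDA : associative vexpD.
Proof. by move=> a b c; apply: val_inj; rewrite /= addrA. Qed.
Fact vexp0D : left_id vexp0 vexpD.
Proof. by move=> a; apply: val_inj; rewrite /= add0r. Qed.
Fact vexpD0 : right_id vexp0 vexpD.
Proof. by move=> a; apply: val_inj; rewrite /= addr0. Qed.
Fact vexpD_eq0 a b : vexpD a b = vexp0 -> a = vexp0 /\ b = vexp0.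
Proof.
move=> /(congr1 vexp_val)/eqP /=.
rewrite paddr_eq0 ?vexp_ge0// => /andP[/eqP a0 /eqP b0].
by split; apply: val_inj.
Qed.
Fact vexpDC : commutative vexpD.
Proof. by move=> a b; apply: val_inj; rewrite /= addrC. Qed.

HB.instance Definition _ :=
  Choice_isMonomialDef.Build vexp vexpDA vexp0D vexpD0 vexpD_eq0.
HB.instance Definition _ := MonomialDef_isConomialDef.Build vexp vexpDC.
End NonnegExponents.

Section Upsilon.
Variable R : realType.

(* Finite sums of powers v^alpha with alpha >= 0 real.                       *)
Definition Fv : comAlgType 'F_2 := {malg 'F_2[vexp R]}.
Definition vpow (a : vexp R) : Fv := << a >>.

Definition homFv (s : R) (p : Fv) : Prop :=
  forall a : vexp R, (p : {malg 'F_2[vexp R]})@_a != 0 -> s = - (a : R).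

Variables (C : cxFUV) (t : R).

(* The exponents 2 - t and t are nonnegative for t in [0, 2]; outside this   *)
(* interval a negative exponent is replaced by 0.                            *)
Definition diff_t : 'M[Fv]_(rk C) :=
  map_mx (substUV (vpow (insubd (vexp0 R) (2 - t))) (vpow (insubd (vexp0 R) t)))
    (diff C).

Definition gr_t (i : 'I_(rk C)) : R :=
  (1 - t / 2) * (grU i)%:~R + t / 2 * (grV i)%:~R.

Definition nontorsion_degree (s : R) : Prop :=
  exists x : 'rV[Fv]_(rk C),
    [/\ forall i, homFv (s - gr_t i) (x 0 i), is_cycle diff_t x
      & forall a : vexp R, ~ is_boundary diff_t (vpow a *: x)].

(* Upsilon(t) = s, for t in [0, 2]. *)
Definition upsilon_eq (s : R) : Prop :=
  nontorsion_degree s /\ forall s', nontorsion_degree s' -> s' <= s.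
End Upsilon.

(* The generators a, b, c, d, e are indexed by 0, 1, 2, 3, 4.                *)
Section Example.
Definition ex_grU (i : 'I_5) : int := [:: 2; -3; -4; 1; 0]`_i.
Definition ex_grV (i : 'I_5) : int := [:: -4; -3; 2; 1; 0]`_i.

Definition ex_diff : 'M[FUV]_5 :=
  \matrix_(i, j)
    (nth [::] [::
      [:: 0; 0; 0; varV ^+ 3; 0];
      [:: varU ^+ 3; 0; varV ^+ 3; 0; 0];
      [:: 0; 0; 0; varU ^+ 3; 0];
      [:: 0; 0; 0; 0; 0];
      [:: 0; 0; 0; varU * varV; 0]] i)`_j.

Fact ex_homog i j :
  homFUV (ex_grU i - 1 - ex_grU j) (ex_grV i - 1 - ex_grV j) (ex_diff i j).
Proof.
rewrite mxE.
case: i => -[|[|[|[|[|//]]]]] ?; case: j => -[|[|[|[|[|//]]]]] ?;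
  rewrite /ex_grU /ex_grV /= ; try exact: homFUV0.
all: first [by apply: homFUV_V | by apply: homFUV_U
  | by apply: (@homFUV_mono _ _ 1 1)].
Qed.

Fact ex_sq : ex_diff *m ex_diff = 0.
Proof.
have ch : forall x : FUV, x + x = 0.
  move=> x; apply/polyP => k; apply/polyP => l; rewrite !coefD !coef0.
  by case: (x`_k`_l) => -[|[|//]] ?; apply: val_inj.
apply/matrixP => i j; rewrite !mxE !big_ord_recl big_ord0 !mxE.
case: i => -[|[|[|[|[|//]]]]] ?; case: j => -[|[|[|[|[|//]]]]] ?;
  rewrite /= ?(mulr0, mul0r, addr0, add0r) //.
by rewrite [_ ^+ 3 * varV ^+ 3]mulrC ch.
Qed.

Definition ex_complex : cxFUV := Complex ex_homog ex_sq.
End Example.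

(* Main.v *)
(* Modulo UV the generator e is a direct summand, and the square a, b, c, d is
   torsion both modulo U and modulo V, so the complex is locally equivalent to
   the trivial one and every phi_j vanishes. That no other standard complex
   C(b_1,...,b_n) is locally trivial is decided by the first edge: a local map
   into or out of C(b_1,...,b_n) has an invertible x_0-coefficient modulo U,
   hence a nonzero one modulo V, and the chain map equation at x_1 kills the
   latter, for a map to the trivial complex if b_1 > 0 and for a map from it if
   b_1 < 0.
   At t = 1 both U and V become v: the tower is generated by a + v e, of degree
   -1, because e alone is not a cycle. So Upsilon(1) = -1. *)
From HB Require Import structures.
Require Import Defs.
From mathcomp Require Import all_boot all_order all_algebra.
From mathcomp Require Import boolp reals.
From mathcomp.multinomials Require Import monalg.
From mathcomp Require Import zify ring lra.

Import Order.TTheory GRing.Theory Num.Theory.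
Local Open Scope ring_scope.

Set Implicit Arguments.
Unset Strict Implicit.

(** * Homogeneous elements and homogeneous maps *)

Lemma sum_neq0 (V : nmodType) (I : Type) (r : seq I) (F : I -> V) :
  \sum_(i <- r) F i != 0 -> exists i, F i != 0.
Proof.
move=> sum_n0; apply: contrapT => allF0; move: sum_n0; rewrite big1 ?eqxx// => i _.
by apply/eqP/negPn/negP => Fi; apply: allF0; exists i.
Qed.

Lemma homFUVD u v p q : homFUV u v p -> homFUV u v q -> homFUV u v (p + q).
Proof.
move=> hp hq m n; rewrite !coefD => pq.
have [p0|/hp//] := eqVneq (p : {poly {poly 'F_2}})`_n`_m 0.
by apply: hq; move: pq; rewrite p0 add0r.
Qed.

Lemma homFUVM u v u' v' p q :
  homFUV u v p -> homFUV u' v' q -> homFUV (u + u') (v + v') (p * q).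
Proof.
move=> hp hq m n; rewrite coefM coef_sum => /sum_neq0[j].
rewrite coefM => /sum_neq0[i]; rewrite mulf_eq0 negb_or => /andP[/hp[-> ->] /hq[-> ->]].
have := ltn_ord i; have := ltn_ord j; lia.
Qed.

Lemma homR0 u v : homR u v 0.
Proof. by exists 0; [exact: homFUV0 | rewrite rmorph0]. Qed.

Lemma homR1 : homR 0 0 1.
Proof. by exists 1; [exact: (@homFUV_U 0 0 0) | rewrite rmorph1]. Qed.

Lemma homRD u v p q : homR u v p -> homR u v q -> homR u v (p + q).
Proof.
by move=> [p' hp ->] [q' hq ->]; exists (p' + q'); [exact: homFUVD | rewrite rmorphD].
Qed.

Lemma homRM u v u' v' p q :
  homR u v p -> homR u' v' q -> homR (u + u') (v + v') (p * q).
Proof.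
by move=> [p' hp ->] [q' hq ->]; exists (p' * q'); [exact: homFUVM | rewrite rmorphM].
Qed.

Lemma homog_map_comp (C1 C2 C3 : cxR) u v u' v'
    (f : 'M[RUV]_(rk C1, rk C2)) (g : 'M[RUV]_(rk C2, rk C3)) :
  homog_map u v f -> homog_map u' v' g -> homog_map (u + u') (v + v') (f *m g).
Proof.
move=> hf hg i j; rewrite mxE; apply: (big_ind (homR _ _)).
- exact: homR0.
- exact: homRD.
- move=> k _; have := homRM (hf i k) (hg k j).
  by congr homR; ring.
Qed.

(** * Reductions modulo U and modulo V, and their common constant term *)

Fact RmodU_is_zmod_morphism : zmod_morphism RmodU.
Proof.
by move=> x y; rewrite -(liftRK x) -(liftRK y) -rmorphB !RmodU_pi rmorphB.
Qed.

Fact RmodU_is_monoid_morphism : monoid_morphism RmodU.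
Proof.
split=> [|x y]; first by rewrite -(rmorph1 piR) RmodU_pi rmorph1.
by rewrite -(liftRK x) -(liftRK y) -rmorphM !RmodU_pi rmorphM.
Qed.

HB.instance Definition _ :=
  GRing.isZmodMorphism.Build RUV {poly 'F_2} RmodU RmodU_is_zmod_morphism.
HB.instance Definition _ :=
  GRing.isMonoidMorphism.Build RUV {poly 'F_2} RmodU RmodU_is_monoid_morphism.

Fact RmodV_is_zmod_morphism : zmod_morphism RmodV.
Proof.
by move=> x y; rewrite -(liftRK x) -(liftRK y) -rmorphB !RmodV_pi rmorphB.
Qed.

Fact RmodV_is_monoid_morphism : monoid_morphism RmodV.
Proof.
split=> [|x y]; first by rewrite -(rmorph1 piR) RmodV_pi rmorph1.
by rewrite -(liftRK x) -(liftRK y) -rmorphM !RmodV_pi rmorphM.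
Qed.

HB.instance Definition _ :=
  GRing.isZmodMorphism.Build RUV {poly 'F_2} RmodV RmodV_is_zmod_morphism.
HB.instance Definition _ :=
  GRing.isMonoidMorphism.Build RUV {poly 'F_2} RmodV RmodV_is_monoid_morphism.

Lemma RmodU_U : RmodU (piR varU) = 0.
Proof. by rewrite RmodU_pi [modU _]substUV_U. Qed.

Lemma RmodU_V : RmodU (piR varV) = 'X.
Proof. by rewrite RmodU_pi [modU _]substUV_V. Qed.

Lemma RmodV_U : RmodV (piR varU) = 'X.
Proof. by rewrite RmodV_pi [modV _]substUV_U. Qed.

Lemma RmodV_V : RmodV (piR varV) = 0.
Proof. by rewrite RmodV_pi [modV _]substUV_V. Qed.

Lemma RmodU_std_var k e : (0 < e)%N ->
  RmodU (std_var k ^+ e) = if odd k then 'X^e else 0.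
Proof.
move=> e0; rewrite rmorphXn /std_var; case: (odd k); rewrite /= ?RmodU_V//.
by rewrite RmodU_U expr0n; case: e e0.
Qed.

Lemma RmodV_std_var k e : (0 < e)%N ->
  RmodV (std_var k ^+ e) = if odd k then 0 else 'X^e.
Proof.
move=> e0; rewrite rmorphXn /std_var; case: (odd k); rewrite /= ?RmodV_U//.
by rewrite RmodV_V expr0n; case: e e0.
Qed.

(** Evaluation at 0 is a ring morphism, so evaluating at a point with zero constant term and then at
    0 amounts to setting U = V = 0. *)
Lemma coef0_substUV (a b : {poly 'F_2}) (p : FUV) :
  a`_0 = 0 -> b`_0 = 0 -> (substUV a b p)`_0 = (p : {poly {poly 'F_2}})`_0`_0.
Proof.
have coef0_horner (q : {poly {poly 'F_2}}) (c : {poly 'F_2}) :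
    c`_0 = 0 -> (q.[c])`_0 = q`_0`_0.
  move=> c0; rewrite -!horner_coef0 -[LHS]/(horner_eval 0 _).
  by rewrite -(horner_map (horner_eval 0)) [X in _.[X]]horner_coef0 c0
    !horner_coef0 coef_map /= /horner_eval horner_coef0.
move=> a0 b0; rewrite coef0_horner // coef_map /= /horner_alg /horner_morph.
by rewrite coef0_horner // coef_map /= alg_polyC coefC.
Qed.

(** Setting U = V = 0 factors through both quotients. This carries information from the quotient by
    U, where locality is tested, to the quotient by V. *)
Lemma coef0_RmodU_RmodV (r : RUV) : (RmodU r)`_0 = (RmodV r)`_0.
Proof. by rewrite !coef0_substUV ?coef0 ?coefX. Qed.

(** * Chain maps, homotopies and torsion *)

Section Homotopy.
Variable S : comNzRingType.

Lemma is_cycle_mulmx n1 n2 (d1 : 'M[S]_n1) (d2 : 'M_n2)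
    (f : 'M_(n1, n2)) x :
  d1 *m f = f *m d2 -> is_cycle d1 x -> is_cycle d2 (x *m f).
Proof. by move=> df dx; rewrite /is_cycle -mulmxA -df mulmxA dx mul0mx. Qed.

Lemma is_boundary_mulmx n1 n2 (d1 : 'M[S]_n1) (d2 : 'M_n2) (f : 'M_(n1, n2)) x :
  d1 *m f = f *m d2 -> is_boundary d1 x -> is_boundary d2 (x *m f).
Proof. by move=> df [y ->]; exists (y *m f); rewrite -!mulmxA df. Qed.

Lemma is_boundaryB n (d : 'M[S]_n) x y :
  is_boundary d x -> is_boundary d y -> is_boundary d (x - y).
Proof. by move=> [x' ->] [y' ->]; exists (x' - y'); rewrite mulmxBl. Qed.

Lemma homotopic_boundary n (d k h : 'M[S]_n) x :
  k - 1%:M = d *m h + h *m d -> is_cycle d x -> is_boundary d (x *m k - x).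
Proof.
move=> hk dx; exists (x *m h).
by rewrite -{2}[x]mulmx1 -mulmxBr hk mulmxDr mulmxA dx mul0mx add0r mulmxA.
Qed.

(** A left inverse up to homotopy makes [f] injective on homology: [x *m f *m g] is a boundary and
    differs from the cycle [x] by a boundary. *)
Lemma homotopic_boundary_inv n1 n2 (d1 h : 'M[S]_n1) (d2 : 'M_n2)
    (f : 'M_(n1, n2)) (g : 'M_(n2, n1)) x :
  f *m g - 1%:M = d1 *m h + h *m d1 -> d2 *m g = g *m d1 ->
  is_cycle d1 x -> is_boundary d2 (x *m f) -> is_boundary d1 x.
Proof.
move=> fg dg cx /(is_boundary_mulmx dg) bx.
have := is_boundaryB bx (homotopic_boundary fg cx).
by rewrite mulmxA opprB addrC subrK.
Qed.
End Homotopy.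

Lemma map_chain_map (S S' : comNzRingType) (phi : {rmorphism S -> S'}) n1 n2
    (d1 : 'M_n1) (d2 : 'M_n2) (f : 'M_(n1, n2)) :
  d1 *m f = f *m d2 ->
  map_mx phi d1 *m map_mx phi f = map_mx phi f *m map_mx phi d2.
Proof. by move=> df; rewrite -!map_mxM df. Qed.

Lemma map_homotopic_id (S S' : comNzRingType) (phi : {rmorphism S -> S'}) n1 n2
    (d h : 'M_n1) (f : 'M_(n1, n2)) (g : 'M_(n2, n1)) :
  f *m g - 1%:M = d *m h + h *m d ->
  map_mx phi f *m map_mx phi g - 1%:M =
    map_mx phi d *m map_mx phi h + map_mx phi h *m map_mx phi d.
Proof. by move=> fg; rewrite -(map_mx1 phi) -!map_mxM -map_mxB fg map_mxD. Qed.

Section Torsion.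
Variables (n : nat) (d : 'M[{poly 'F_2}]_n).
Implicit Types x y : 'rV[{poly 'F_2}]_n.

Lemma is_torsion0 : is_torsion d 0.
Proof. by exists 0%N, 0; rewrite scaler0 mul0mx. Qed.

Lemma boundary_torsion x : is_boundary d x -> is_torsion d x.
Proof. by exists 0%N; rewrite scale1r. Qed.

Lemma is_torsionD x y : is_torsion d x -> is_torsion d y -> is_torsion d (x + y).
Proof.
move=> [k [x' hx]] [l [y' hy]]; exists (k + l)%N, ('X^l *: x' + 'X^k *: y').
by rewrite mulmxDl -!scalemxAl -hx -hy !scalerA -!exprD [(l + k)%N]addnC scalerDr.
Qed.
End Torsion.

Lemma is_torsion_mulmx n1 n2 (d1 : 'M[{poly 'F_2}]_n1) (d2 : 'M_n2) (f : 'M_(n1, n2)) x :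
  d1 *m f = f *m d2 -> is_torsion d1 x -> is_torsion d2 (x *m f).
Proof.
move=> df [k [y xy]]; exists k, (y *m f).
by rewrite -mulmxA -df mulmxA -xy scalemxAl.
Qed.

(** * The local order and its behaviour under homotopy equivalence *)

Lemma chain_map_modU (C1 C2 : cxR) (f : 'M[RUV]_(rk C1, rk C2)) :
  chain_map f ->
  diffmodU C1 *m map_mx RmodU f = map_mx RmodU f *m diffmodU C2.
Proof. exact: map_chain_map. Qed.

Lemma local_le_trans (C1 C2 C3 : cxR) :
  local_le C1 C2 -> local_le C2 C3 -> local_le C1 C3.
Proof.
move=> [f [cf [v hf] [fi fs]]] [g [cg [w hg] [gi gs]]]; exists (f *m g); split.
- by rewrite /chain_map mulmxA cf -mulmxA cg mulmxA.
- by exists (v + w); rewrite -[0]addr0; apply: homog_map_comp.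
have cf' := chain_map_modU cf; have cg' := chain_map_modU cg.
split=> [x cx|y cy]; rewrite map_mxM.
  by rewrite mulmxA => /gi/fi; apply=> //; exact: is_cycle_mulmx cf' cx.
(* A preimage is chosen first under [g], then under [f]; the torsion error of the second choice
   stays torsion when pushed through [g]. *)
have [y' cy' ty'] := gs _ cy; have [x cx tx] := fs _ cy'; exists x => //.
have := is_torsionD (is_torsion_mulmx cg' tx) ty'.
by rewrite mulmxBl addrA subrK mulmxA.
Qed.

Lemma homotopy_equivalent_sym (S : comNzRingType) (hom : int -> int -> S -> Prop)
    (C1 C2 : complex hom) :
  homotopy_equivalent C1 C2 -> homotopy_equivalent C2 C1.
Proof. by move=> [f [g [hf hg fg gf]]]; exists g, f. Qed.

Lemma map_RmodU_piR m n (A : 'M[FUV]_(m, n)) :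
  map_mx RmodU (map_mx piR A) = map_mx modU A.
Proof. by apply/matrixP => i j; rewrite !mxE RmodU_pi. Qed.

(** Modulo U, the homotopy on [C1] gives injectivity, applied to the cycle ['X^k *: x]; the homotopy
    on [C2] gives surjectivity, with the image of [y] under [g] as preimage. *)
Lemma homotopy_equivalent_local_le (C1 C2 : cxFUV) :
  homotopy_equivalent C1 C2 -> local_le (modUV C1) (modUV C2).
Proof.
move=> [f [g [[hf cf] [_ cg] [h1 _ fg] [h2 _ gf]]]].
exists (map_mx piR f); split.
- by rewrite /chain_map -!map_mxM cf.
- by exists 0 => i j; rewrite mxE; exists (f i j) => //; apply: hf.
rewrite /tower_iso /diffmodU /= /modUV_diff !map_RmodU_piR; split=> [x cx [k]|y cy].
  rewrite scalemxAl => bx; exists k.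
  apply: (homotopic_boundary_inv (map_homotopic_id modU fg) (map_chain_map modU cg)) bx.
  by rewrite /is_cycle -scalemxAl [x *m _]cx scaler0.
exists (y *m map_mx modU g); first exact: is_cycle_mulmx (map_chain_map modU cg) cy.
rewrite -mulmxA; apply/boundary_torsion.
exact: homotopic_boundary (map_homotopic_id modU gf) cy.
Qed.

(** * The example complex is locally equivalent to the trivial one *)

(** The target ring is arbitrary so that one computation serves both the reduction modulo U and the
    substitution at t = 1. *)
Lemma ex_diffE (S : comNzRingType) (phi : {rmorphism FUV -> S}) (y : 'rV[S]_5) :
  y *m map_mx phi ex_diff =
    (y 0 1 * phi varU ^+ 3) *: delta_mx 0 0 + (y 0 1 * phi varV ^+ 3) *: delta_mx 0 2%:R
    + (y 0 0 * phi varV ^+ 3 + y 0 2%:R * phi varU ^+ 3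
       + y 0 4%:R * (phi varU * phi varV)) *: delta_mx 0 3%:R.
Proof.
have y1 : y 0 (lift ord0 ord0) = y 0 1 by congr (y _ _); exact: val_inj.
have y2 : y 0 (lift ord0 (lift ord0 ord0)) = y 0 2%:R by congr (y _ _); exact: val_inj.
have y4 : y 0 (lift ord0 (lift ord0 (lift ord0 (lift ord0 ord0)))) = y 0 4%:R.
  by congr (y _ _); exact: val_inj.
apply/rowP => j; rewrite !mxE !big_ord_recl big_ord0 !mxE y1 y2 y4.
by case: j => -[|[|[|[|[|//]]]]] hj; rewrite /= ?rmorph0 ?(rmorphXn, rmorphM)
  ?(mulr0, mulr1, addr0, add0r) ?addrA.
Qed.

Lemma diffmodU_ex (y : 'rV_5) : y *m diffmodU (modUV ex_complex) =
  (y 0 1 * 'X^3) *: delta_mx 0 2%:R + (y 0 0 * 'X^3) *: delta_mx 0 3%:R.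
Proof.
have -> : diffmodU (modUV ex_complex) = map_mx modU ex_diff by exact: map_RmodU_piR.
have hU : modU varU = 0 by exact: substUV_U.
have hV : modU varV = 'X by exact: substUV_V.
by rewrite ex_diffE /= hU hV expr0n mul0r !mulr0 scale0r add0r !addr0.
Qed.

(** Modulo U only ∂b = V^3 c and ∂a = V^3 d survive. A cycle thus has no a or b component, its c and
    d components are torsion, and the e component is all that remains. *)
Lemma ex_cycle_torsion y : is_cycle (diffmodU (modUV ex_complex)) y ->
  is_torsion (diffmodU (modUV ex_complex)) (y 0 4%:R *: delta_mx 0 4%:R - y).
Proof.
rewrite /is_cycle diffmodU_ex => /rowP cy.
have X3 (p : {poly 'F_2}) : p * 'X^3 = 0 -> p = 0.
  by move/eqP; rewrite mulf_eq0 expf_eq0 polyX_eq0 orbF => /eqP.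
have ya : y 0 0 = 0 by apply: X3; have := cy 3%:R; rewrite !mxE /= mulr0 mulr1 add0r.
have yb : y 0 1 = 0 by apply: X3; have := cy 2%:R; rewrite !mxE /= mulr0 mulr1 addr0.
(* Since b and a bound V^3 c and V^3 d, they receive the coefficients of c and d. *)
exists 3%N, (- (y 0 2%:R *: delta_mx 0 1 + y 0 3%:R *: delta_mx 0 0)).
rewrite diffmodU_ex; apply/rowP => j; rewrite !mxE /=.
have yj (i : 'I_5) : i = j :> nat -> y 0 j = y 0 i by move=> /val_inj ->.
case: j yj => -[|[|[|[|[|//]]]]] hj yj; rewrite /=
  ?(mulr0, mulr1, addr0, add0r, sub0r, mulrN, mulNr) ?(mulrC 'X^3) //.
- by rewrite (yj 0) // ya mul0r oppr0.
- by rewrite (yj 1) // yb mul0r oppr0.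
- by rewrite (yj 2%:R).
- by rewrite (yj 3%:R).
- by rewrite (yj 4%:R) // subrr mul0r.
Qed.

Lemma diff_trivial : diff (std_complex [::]) = 0.
Proof. by apply/matrixP => i j; rewrite !mxE (ord1 i) (ord1 j). Qed.

Lemma diffmodU_trivial : diffmodU (std_complex [::]) = 0.
Proof. by rewrite /diffmodU diff_trivial map_mx0. Qed.

Lemma cycle_trivial x : is_cycle (diffmodU (std_complex [::])) x.
Proof. by rewrite /is_cycle diffmodU_trivial mulmx0. Qed.

Lemma torsion_trivial x : is_torsion (diffmodU (std_complex [::])) x -> x = 0.
Proof.
rewrite diffmodU_trivial => -[k [z]]; rewrite mulmx0 => /eqP.
by rewrite scalemx_eq0 expf_eq0 polyX_eq0 andbF /= => /eqP.
Qed.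

(** The generator goes to e, which has the same bidegree (0, 0). This is a chain map because ∂e = UV
    d vanishes in the quotient by UV. *)
Lemma trivial_local_le_ex : local_le (std_complex [::]) (modUV ex_complex).
Proof.
exists (delta_mx 0 4%:R); split.
- rewrite /chain_map diff_trivial mul0mx -rowE; apply/rowP => j; rewrite !mxE.
  case: j => -[|[|[|[|[|//]]]]] hj; rewrite /= ?rmorph0 //.
  by rewrite rmorphM /= piR_UV.
- exists 0 => i j; rewrite mxE (ord1 i) /=; case: eqP => [->|_]; last exact: homR0.
  by rewrite /std_grU /std_grV big_geq // big_geq //; exact: homR1.
rewrite /tower_iso map_delta_mx diffmodU_trivial; split=> [x _|y cy].
  (* No boundary has an e component, so a torsion multiple of e is zero. *)
  move=> [k [z]]; rewrite diffmodU_ex => /rowP/(_ 4%:R).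
  rewrite !mxE big_ord1 !mxE /= !mulr0 addr0 mulr1 => /eqP.
  rewrite mulf_eq0 expf_eq0 polyX_eq0 andbF /= => /eqP x0.
  suff -> : x = 0 by exact: is_torsion0.
  by apply/rowP => j; rewrite (ord1 j) x0 mxE.
exists (y 0 4%:R)%:M; first by rewrite /is_cycle mulmx0.
by rewrite mul_scalar_mx; exact: ex_cycle_torsion.
Qed.

(** The map reads off the e coordinate; it is a chain map because e occurs in no differential. *)
Lemma ex_local_le_trivial : local_le (modUV ex_complex) (std_complex [::]).
Proof.
exists (delta_mx 4%:R 0); split.
- rewrite /chain_map diff_trivial -colE mulmx0; apply/colP => i; rewrite !mxE.
  by case: i => -[|[|[|[|[|//]]]]] hi; rewrite /= rmorph0.
- exists 0 => i j; rewrite mxE (ord1 j) andbT; case: eqP => [->|_]; last exact: homR0.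
  by rewrite /= /std_grU /std_grV big_geq // big_geq //; exact: homR1.
rewrite /tower_iso map_delta_mx; split=> [x cx /torsion_trivial|y cy].
  rewrite -colE => /rowP/(_ 0); rewrite !mxE => x4.
  have [k [z xz]] := ex_cycle_torsion cx; exists k, (- z).
  by rewrite mulNmx -xz x4 scale0r sub0r scalerN opprK.
exists (y 0 0 *: delta_mx 0 4%:R).
  by rewrite /is_cycle diffmodU_ex !mxE /= !mulr0 !mul0r !scale0r addr0.
rewrite -scalemxAl mul_delta_mx (_ : _ - _ = 0); first exact: is_torsion0.
by apply/rowP => j; rewrite (ord1 j) !mxE mulr1 subrr.
Qed.

(** * Standard complexes locally equivalent to the trivial one *)

Lemma RmodU_std_diff b (i j : 'I_(size b).+1) : RmodU (std_diff b i j) =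
  if [&& j == i.+1 :> nat, b`_i < 0 & odd i] then 'X^`|b`_i|
  else if [&& i == j.+1 :> nat, 0 < b`_j & odd j] then 'X^`|b`_j| else 0.
Proof.
rewrite mxE; case: (boolP (_ && _)) => [/andP[/eqP ji bi]|Nij].
  rewrite ji eqxx bi RmodU_std_var; last by lia.
  by case: (odd i) => //=; case: eqP => //=; lia.
rewrite andbA (negbTE Nij) /=; case: (boolP (_ && _)) => [/andP[/eqP ij bj]|Nji].
  by rewrite ij eqxx bj RmodU_std_var; last by lia.
by rewrite andbA (negbTE Nji) rmorph0.
Qed.

Lemma RmodV_std_diff b (i j : 'I_(size b).+1) : RmodV (std_diff b i j) =
  if [&& j == i.+1 :> nat, b`_i < 0 & ~~ odd i] then 'X^`|b`_i|
  else if [&& i == j.+1 :> nat, 0 < b`_j & ~~ odd j] then 'X^`|b`_j| else 0.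
Proof.
rewrite mxE; case: (boolP (_ && _)) => [/andP[/eqP ji bi]|Nij].
  rewrite ji eqxx bi RmodV_std_var; last by lia.
  by case: (odd i) => //=; case: eqP => //=; lia.
rewrite andbA (negbTE Nij) /=; case: (boolP (_ && _)) => [/andP[/eqP ij bj]|Nji].
  by rewrite ij eqxx bj RmodV_std_var; [case: odd|lia].
by rewrite andbA (negbTE Nji) rmorph0.
Qed.

(** Modulo U only the V-edges survive, each joining x_m to x_(m+1) for some odd m. The hypothesis
    puts exactly one of [i], [j] in such a pair, so each pair splits off as a direct summand. *)
Lemma diffmodU_std_eq0 b (i j : 'I_(size b).+1) m :
  odd m -> ((i == m :> nat) || (i == m.+1 :> nat)) !=
           ((j == m :> nat) || (j == m.+1 :> nat)) ->
  diffmodU (std_complex b) i j = 0.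
Proof.
move=> om ijm; rewrite mxE RmodU_std_diff.
by case: ifP => [/and3P[/eqP ji _ oi]|_]; [lia|case: ifP => [/andP[/eqP]|//]; lia].
Qed.

(* Modulo U the generators x_m and x_(m+1), m odd, span a two-step complex
   with V-torsion homology. *)
Lemma std_pairing_eq0 b (x : 'rV_(size b).+1) (h : 'cV_(size b).+1) k :
  standard_seq b -> x *m diffmodU (std_complex b) = 0 ->
  diffmodU (std_complex b) *m h = 0 -> k != 0 -> x 0 k * h k 0 = 0.
Proof.
move=> /andP[eb /allP b0] /rowP xD /colP Dh k0.
have {}k0 : (0 < k)%N by rewrite lt0n.
(* Since [size b] is even, every positive index is matched: m is [k] if [k] is odd and [k.-1]
   otherwise. *)
have [m [om mb km]] : exists m, [/\ odd m, (m < size b)%N & (k == m :> nat) || (k == m.+1 :> nat)].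
  by have := ltn_ord k; case: (boolP (odd k)) => ok; [exists k | exists k.-1]; split; lia.
have bm0 : b`_m != 0 by apply/b0/mem_nth.
pose D := diffmodU (std_complex b).
pose p := @Ordinal (size b).+1 m (leqW mb); pose q := @Ordinal (size b).+1 m.+1 mb.
have D0 i j : (i == p) || (i == q) != (j == p) || (j == q) -> D i j = 0.
  exact: diffmodU_std_eq0.
have Dii i : D i i = 0.
  rewrite mxE RmodU_std_diff; case: ifP => [/andP[/eqP]|_]; first lia.
  by case: ifP => [/andP[/eqP]|//]; lia.
have Dpq : D p q = if b`_m < 0 then 'X^`|b`_m| else 0.
  rewrite mxE RmodU_std_diff /= eqxx om andbT; case: (b`_m < 0) => //.
  by case: ifP => [/andP[/eqP]|//]; lia.
have Dqp : D q p = if 0 < b`_m then 'X^`|b`_m| else 0.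
  rewrite mxE RmodU_std_diff /= om; case: ifP => [/andP[/eqP]|_]; first lia.
  by rewrite eqxx andbT.
have qp : q != p by rewrite -val_eqE /= gtn_eqF.
have colD l : (l == p) || (l == q) -> x 0 p * D p l + x 0 q * D q l = 0.
  move=> lpq; have := xD l; rewrite mxE [X in _ = X -> _]mxE.
  rewrite (bigD1 p) //= (bigD1 q) //= big1 ?addr0 //.
  by move=> i /andP[/negbTE ip /negbTE iq]; rewrite -/D D0 ?mulr0 // ip iq lpq.
have rowD l : (l == p) || (l == q) -> D l p * h p 0 + D l q * h q 0 = 0.
  move=> lpq; have := Dh l; rewrite mxE [X in _ = X -> _]mxE.
  rewrite (bigD1 p) //= (bigD1 q) //= big1 ?addr0 //.
  by move=> i /andP[/negbTE ip /negbTE iq]; rewrite -/D D0 ?mul0r // ip iq lpq.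
have := (colD p, colD q, rowD p, rowD q).
rewrite !eqxx orbT !Dii Dpq Dqp !mulr0 !mul0r !addr0 !add0r.
have X0 e (r : {poly 'F_2}) : 'X^e * r = 0 -> r = 0.
  by move/eqP; rewrite mulf_eq0 expf_eq0 polyX_eq0 andbF => /eqP.
(* If the edge runs from x_m to x_(m+1), the cycle has no x_m component and [h], which kills
   boundaries, vanishes on x_(m+1). If it runs backwards, the roles are exchanged. *)
have [bneg|bpos|b_eq0] := ltgtP b`_m 0; last by rewrite b_eq0 eqxx in bm0.
  case=> [[[_ /(_ isT)]]]; rewrite mulrC => /X0 xp /(_ isT)/X0 hq _.
  by have /orP[/eqP|/eqP] : (k == p) || (k == q) by []; move=> ->; rewrite ?xp ?hq ?mul0r ?mulr0.
case=> [[[/(_ isT)]]]; rewrite mulrC => /X0 xq _ _ /(_ isT)/X0 hp.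
by have /orP[/eqP|/eqP] : (k == p) || (k == q) by []; move=> ->; rewrite ?xq ?hp ?mul0r ?mulr0.
Qed.

(** The only possible edge at x_0 carries a power of U, so x_0 is isolated modulo U. *)
Lemma diffmodU_std_edge0 b (i j : 'I_(size b).+1) :
  (i == 0) || (j == 0) -> diffmodU (std_complex b) i j = 0.
Proof.
move=> ij; rewrite mxE RmodU_std_diff.
have {}ij : (i == 0 :> nat) || (j == 0 :> nat) by [].
by case: ifP => [/and3P[/eqP ji _ oi]|_]; [lia|case: ifP => [/andP[/eqP]|//]; lia].
Qed.

(** An invertible polynomial has a nonzero constant term, and [RmodU r] shares its constant term
    with [RmodV r]. *)
Lemma RmodU_unit_RmodV_neq0 (r : RUV) (a : {poly 'F_2}) : a * RmodU r = 1 -> RmodV r != 0.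
Proof.
move/(congr1 (fun p : {poly 'F_2} => p`_0)); rewrite coef0M coef0_RmodU_RmodV coef1 => ar.
by apply: contra_eq_neq ar => ->; rewrite coef0 mulr0 eq_sym oner_eq0.
Qed.

Lemma std_le_trivial_head c b : standard_seq (c :: b) ->
  local_le (std_complex (c :: b)) (std_complex [::]) -> ~ 0 < c.
Proof.
move=> sb [g [dg _ [_ gs]]] c0.
(* The trivial complex has no torsion, so surjectivity yields a cycle mapped exactly to 1. *)
have [x cx /torsion_trivial/matrixP/(_ 0 0)] := gs 1%:M (cycle_trivial _).
have dgU : diffmodU (std_complex (c :: b)) *m map_mx RmodU g = 0.
  by rewrite (chain_map_modU dg) diffmodU_trivial mulmx0.
rewrite mxE [X in X + _]mxE [X in _ + X]mxE [X in _ = X -> _]mxE => /eqP.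
(* The pairing lemma removes every term but that of x_0, whose coefficient in [g] is therefore a
   unit modulo U. *)
rewrite subr_eq0 [X in _ == X]mxE eqxx (bigD1 ord0) //= big1 => [|k k0]; last first.
  exact: (std_pairing_eq0 sb cx dgU k0).
rewrite addr0 mxE => /eqP/RmodU_unit_RmodV_neq0/negP; apply; apply/eqP.
pose i1 : 'I_(size b).+2 := lift ord0 ord0.
(* The chain map equation at x_1 modulo V: the edge to x_0 contributes U^c, while any edge between
   x_1 and x_2 carries a power of V and vanishes. So U^c annihilates the x_0 coefficient. *)
have := congr1 (fun M : 'M[RUV]_(_, _) => RmodV (M i1 0)) dg.
rewrite diff_trivial mulmx0 mxE [in RHS]mxE rmorph0 rmorph_sum (bigD1 ord0) //= big1 => [|k k0].
  rewrite addr0 rmorphM [X in X * _]RmodV_std_diff /= c0 => /eqP.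
  by rewrite mulf_eq0 expf_eq0 polyX_eq0 andbF => /eqP.
have {}k0 : (0 < k)%N by rewrite lt0n.
rewrite rmorphM [X in X * _]RmodV_std_diff; case: ifP => [/and3P[]|_]; first by [].
by case: ifP => [/andP[/eqP]|_]; [move=> /= [] k1; rewrite -k1 in k0 | rewrite mul0r].
Qed.

Lemma trivial_le_std_head c b : standard_seq (c :: b) ->
  local_le (std_complex [::]) (std_complex (c :: b)) -> ~ c < 0.
Proof.
move=> sb [f [df _ [_ fs]]] c0.
have [|x _ [k [z]]] := fs (delta_mx 0 0).
  rewrite /is_cycle -rowE; apply/rowP => j; rewrite mxE diffmodU_std_edge0 ?mxE //.
(* Modulo U no boundary has an x_0 component, so the torsion relation at x_0 says that V^k
   annihilates the difference from 1. *)
move=> /matrixP/(_ 0 0); rewrite [in RHS]mxE big1 => [|i _]; last first.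
  by rewrite diffmodU_std_edge0 ?mulr0 ?orbT.
move/eqP; rewrite mxE mulf_eq0 expf_eq0 polyX_eq0 andbF /= !mxE big_ord1 mxE subr_eq0.
move=> /eqP/RmodU_unit_RmodV_neq0/negP; apply; apply/eqP.
pose i1 : 'I_(size b).+2 := lift ord0 ord0.
(* Dually, the edge now runs from x_0 to x_1, and the x_1 component modulo V makes U^|c| annihilate
   the x_0 coefficient of [f]. *)
have := congr1 (fun M : 'M[RUV]_(_, _) => RmodV (M 0 i1)) df.
rewrite diff_trivial mul0mx mxE [in RHS]mxE rmorph0 rmorph_sum (bigD1 ord0) //= big1 => [|l l0].
  rewrite addr0 rmorphM [X in _ * X]RmodV_std_diff /= c0 => /esym/eqP.
  by rewrite mulf_eq0 expf_eq0 polyX_eq0 andbF orbF => /eqP.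
have {}l0 : (0 < l)%N by rewrite lt0n.
rewrite rmorphM [X in _ * X]RmodV_std_diff.
case: ifP => [/andP[/eqP /= [] l1]|_]; first by rewrite -l1 in l0.
by case: ifP => [/and3P[]|_]; last rewrite mulr0.
Qed.

Lemma std_locally_trivial b : standard_seq b ->
  local_le (std_complex b) (std_complex [::]) ->
  local_le (std_complex [::]) (std_complex b) -> b = [::].
Proof.
case: b => // c b sb /(std_le_trivial_head sb) cpos /(trivial_le_std_head sb) cneg.
by case/andP: sb => _ /= /andP[]; case: ltgtP.
Qed.

(** * Vanishing of every φ_j *)

(** The empty sequence is a representative, and by transitivity any other one is locally trivial,
    hence empty. Both counts then range over an empty index set. *)
Lemma phi_eq_ex (C : cxFUV) (j : nat) :
  homotopy_equivalent C ex_complex -> phi_eq (modUV C) j 0.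
Proof.
move=> hC; have leC := homotopy_equivalent_local_le hC.
have geC := homotopy_equivalent_local_le (homotopy_equivalent_sym hC).
have leT := local_le_trans leC ex_local_le_trivial.
have geT := local_le_trans trivial_local_le_ex geC.
exists [::]; last first.
  by rewrite /odd_count !eq_card0 // => -[].
split=> [|b [sb [leb geb]]]; first by [].
apply/esym/std_locally_trivial => //; first exact: local_le_trans geb leT.
exact: local_le_trans geT leb.
Qed.

(** * Substitution of powers of v, and the grading gr_t *)

(** The expansion into monomials lets homogeneity be checked term by term. *)
Lemma substUVE (S : comAlgType 'F_2) (a b : S) (p : FUV) :
  exists (n : nat) (m : 'I_n -> nat), substUV a b p =
  \sum_(j < n) \sum_(i < m j) (p : {poly {poly 'F_2}})`_j`_i *: (a ^+ i * b ^+ j).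
Proof.
pose q := map_poly (horner_alg a) p.
exists (size q), (fun j => size (map_poly (in_alg S) ((p : {poly {poly 'F_2}})`_j))).
rewrite [LHS]horner_coef; apply: eq_bigr => j _.
rewrite coef_map /= /horner_alg /horner_morph horner_coef mulr_suml.
by apply: eq_bigr => i _; rewrite coef_map /= -[_%:A * _]scalerAl mul1r -scalerAl.
Qed.

Section Upsilon.
Variable R : realType.
Implicit Types (a b : vexp R) (p q : Fv R) (s t : R).

Lemma vpowD a b : vpow (vexpD a b) = vpow a * vpow b.
Proof. by rewrite /vpow [RHS]malgM_def fgmulUU mulr1. Qed.

(** Adding [a] to exponents is injective, so multiplication by v^a merely shifts coefficients; hence
    v^a is not a zero divisor. *)
Lemma mcoeff_vpowM a b p :
  (vpow a * p : {malg 'F_2[vexp R]})@_(vexpD a b) = (p : {malg 'F_2[vexp R]})@_b.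
Proof.
rewrite malgM_def fgmulUg raddf_sum /=.
rewrite [in RHS](monalgE p) raddf_sum /=; apply: eq_bigr => c _.
rewrite !mcoeffU mul1r; congr (_ *+ nat_of_bool _).
apply/eqP/eqP => [|-> //] /(congr1 val) /= /addrI ?; exact: val_inj.
Qed.

Lemma vpowM_eq0 a p : vpow a * p = 0 -> p = 0.
Proof.
by move=> vp; apply/malgP => b; rewrite -(mcoeff_vpowM a) vp !mcoeff0.
Qed.

Lemma vpow_neq0 a : vpow a != 0.
Proof. by rewrite monalgU_eq0 oner_eq0. Qed.

Lemma homFv0 s : homFv s (0 : Fv R).
Proof. by move=> a; rewrite mcoeff0 eqxx. Qed.

Lemma homFv_vpow s a : s = - (a : R) -> homFv s (vpow a).
Proof.
by move=> -> b; rewrite mcoeffU1; case: (eqVneq a b) => [->|]; rewrite ?eqxx.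
Qed.

Lemma homFv1 : homFv 0 (1 : Fv R).
Proof. by apply: (@homFv_vpow 0 (vexp0 R)); rewrite oppr0. Qed.

Lemma homFvD s p q : homFv s p -> homFv s q -> homFv s (p + q).
Proof.
move=> hp hq a; rewrite mcoeffD => pq.
by have [p0|/hp//] := eqVneq (p : {malg 'F_2[vexp R]})@_a 0; apply: hq; rewrite p0 add0r in pq.
Qed.

Lemma homFv_sum s (I : finType) (F : I -> Fv R) :
  (forall i, homFv s (F i)) -> homFv s (\sum_i F i).
Proof. by move=> hF; apply: (big_ind (homFv s)) => //; [exact: homFv0 | exact: homFvD]. Qed.

Lemma homFvZ s (c : 'F_2) p : homFv s p -> homFv s (c *: p).
Proof. by move=> hp a; rewrite mcoeffZ mulf_eq0 negb_or => /andP[_ /hp]. Qed.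

Lemma homFvM s s' p q : homFv s p -> homFv s' q -> homFv (s + s') (p * q).
Proof.
move=> hp hq a; rewrite mcoeff_neq0 => /msuppM_le[b [c [bp cq ->]]].
by rewrite (hp b) ?(hq c) ?mcoeff_neq0 //= opprD.
Qed.

Lemma homFvX s p n : homFv s p -> homFv (s *+ n) (p ^+ n).
Proof.
move=> hp; elim: n => [|n IH]; first exact: homFv1.
by rewrite mulrS exprS; exact: homFvM.
Qed.

(** Exponents are nonnegative and v has degree -1, so nonzero homogeneous elements have degree at
    most 0. *)
Lemma homFv_pos s p : 0 < s -> homFv s p -> p = 0.
Proof.
move=> s0 hp; apply/malgP => a; rewrite mcoeff0; apply/eqP; apply: contraTT s0 => /hp ->.
by rewrite -leNgt oppr_le0 vexp_ge0.
Qed.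

Lemma insubd_vexp t : 0 <= t -> insubd (vexp0 R) t = t :> R.
Proof. by move=> t0; have := val_insubd (vexp0 R) t; rewrite t0. Qed.

Definition subst_t t : FUV -> Fv R :=
  substUV (vpow (insubd (vexp0 R) (2 - t))) (vpow (insubd (vexp0 R) t)).

HB.instance Definition _ t := GRing.RMorphism.on (subst_t t).

(** The monomial U^i V^j becomes v to the power (2 - t) i + t j, whose degree is gr_t of the
    bidegree (-2i, -2j). *)
Lemma homFv_subst_t t u v (p : FUV) : 0 <= t <= 2 -> homFUV u v p ->
  homFv ((1 - t / 2) * u%:~R + t / 2 * v%:~R) (subst_t t p).
Proof.
move=> /andP[t0 t2] hp; have [n [m E]] := substUVE (vpow (insubd (vexp0 R) (2 - t)))
  (vpow (insubd (vexp0 R) t)) p.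
rewrite /subst_t E; apply: homFv_sum => j; apply: homFv_sum => i.
have [->|/hp[-> ->]] := eqVneq ((p : {poly {poly 'F_2}})`_j)`_i 0.
  by rewrite scale0r; exact: homFv0.
apply: homFvZ.
have -> : (1 - t / 2) * (- (2 * i)%:Z)%:~R + t / 2 * (- (2 * j)%:Z)%:~R =
    (- (2 - t)) *+ i + (- t) *+ j :> R.
  by rewrite !intrN !PoszM !intrM -!pmulrn -[in RHS]mulr_natr -[X in _ = _ + X]mulr_natr; field.
by apply: homFvM; apply/homFvX/homFv_vpow; rewrite insubd_vexp; lra.
Qed.

(** A map of bidegree (0, 0) preserves gr_t after substitution, and its homotopy inverse prevents
    multiples v^a x of a nontorsion class from becoming boundaries. *)
Lemma nontorsion_degree_homotopy (C1 C2 : cxFUV) t s : 0 <= t <= 2 ->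
  homotopy_equivalent C1 C2 -> nontorsion_degree C1 t s -> nontorsion_degree C2 t s.
Proof.
move=> t02 [f [g [[hf cf] [_ cg] [h _ fg] _]]] [x [hx cx tx]].
exists (x *m map_mx (subst_t t) f); split=> [j||a].
- rewrite mxE; apply: homFv_sum => i; rewrite [X in _ * X]mxE.
  have := homFvM (hx i) (homFv_subst_t t02 (hf i j)).
  rewrite /gr_t !addr0 !intrB; congr homFv; ring.
- by apply: is_cycle_mulmx cx; exact: map_chain_map.
rewrite scalemxAl => bx; apply: (tx a).
apply: (homotopic_boundary_inv (map_homotopic_id (subst_t t) fg) (map_chain_map _ cg)) bx.
by rewrite /is_cycle -scalemxAl [x *m _]cx scaler0.
Qed.
End Upsilon.

(** * The example at t = 1, where U and V have the same image v *)

Section ExampleSubst.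
Variables (S : comAlgType 'F_2) (phi : {rmorphism FUV -> S}) (v : S).
Hypotheses (phiU : phi varU = v) (phiV : phi varV = v).
Let d := map_mx phi ex_diff.

Definition ex_class : 'rV[S]_5 := delta_mx 0 0 + v *: delta_mx 0 4%:R.

Lemma ex_class_cycle : is_cycle d ex_class.
Proof.
rewrite /is_cycle ex_diffE phiU phiV !mxE /=.
rewrite !(mulr0, mul0r, mulr1, mul1r, addr0, add0r, scale0r) -expr2 -exprS.
(* Both ∂a and ∂(v e) equal v^3 d; writing the coefficients as multiples by scalars of F_2 reduces
   their cancellation to 1 + 1 = 0 there. *)
rewrite -[_ ^+ 3]scale1r -scalerDl.
by rewrite (_ : 1 + 1 = 0) ?scale0r //; exact: val_inj.
Qed.

(** The e component of the multiple is c v, whereas boundaries have none. *)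
Lemma ex_class_not_boundary (c : S) : c * v != 0 -> ~ is_boundary d (c *: ex_class).
Proof.
move=> cv [y /rowP/(_ 4%:R)]; rewrite ex_diffE !mxE /= !mulr0 !addr0 add0r mulr1.
exact/eqP.
Qed.

(** With only d and e components left, the cycle condition says that v^2 kills the e coefficient. So
    [x] is a multiple of d, and v^3 d = ∂a. *)
Lemma ex_torsion (x : 'rV[S]_5) : (forall r, v ^+ 2 * r = 0 -> r = 0) ->
  x 0 0 = 0 -> x 0 1 = 0 -> x 0 2%:R = 0 -> is_cycle d x -> is_boundary d (v ^+ 3 *: x).
Proof.
move=> v_reg xa xb xc cx.
have xe : x 0 4%:R = 0.
  apply: v_reg; move: cx; rewrite /is_cycle ex_diffE xa xb xc phiU phiV => /rowP/(_ 3%:R).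
  by rewrite !mxE /= !mul0r !add0r mulr1 mulrC.
exists (x 0 3%:R *: delta_mx 0 0).
rewrite ex_diffE phiU phiV; apply/rowP => j; rewrite !mxE /= !(mulr0, mul0r, addr0, add0r) mulr1.
have xj (i : 'I_5) : i = j :> nat -> x 0 j = x 0 i by move=> /val_inj ->.
case: j xj => -[|[|[|[|[|//]]]]] hj xj; rewrite /= ?mulr0 ?mulr1.
- by rewrite (xj 0) // xa mulr0.
- by rewrite (xj 1) // xb mulr0.
- by rewrite (xj 2%:R) // xc mulr0.
- by rewrite (xj 3%:R) // mulrC.
- by rewrite (xj 4%:R) // xe mulr0.
Qed.
End ExampleSubst.

Lemma upsilon_ex (R : realType) (C : cxFUV) :
  homotopy_equivalent C ex_complex -> upsilon_eq C 1 (- 1 : R).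
Proof.
move=> hC; have t02 : 0 <= (1 : R) <= 2 by rewrite ler01 ler1n.
pose v1 := VExp (@ler01 R).
have vE : insubd (vexp0 R) (2 - 1) = v1 /\ insubd (vexp0 R) 1 = v1.
  by split; apply: val_inj; rewrite /= insubd_vexp; lra.
have phiU : subst_t 1 varU = vpow v1 by rewrite -vE.1; exact: substUV_U.
have phiV : subst_t 1 varV = vpow v1 by rewrite -vE.2; exact: substUV_V.
have gr_tE (i : 'I_5) : gr_t (C := ex_complex) 1 i = [:: -1; -3; -1; 1; 0]`_i :> R.
  by case: i => -[|[|[|[|[|//]]]]] hi; rewrite /gr_t /= /ex_grU /ex_grV /=; lra.
split.
  (* The tower class is exhibited in the model and transported to [C]; the upper bound below moves
     classes the other way. *)
  apply: (nontorsion_degree_homotopy t02 (homotopy_equivalent_sym hC)).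
  exists (ex_class (vpow v1)); split.
  - move=> i; rewrite gr_tE !mxE.
    case: i => -[|[|[|[|[|//]]]]] hi; rewrite /= ?mulr0 ?mulr1 ?addr0 ?add0r; try exact: homFv0.
      by rewrite subrr; exact: homFv1.
    by rewrite subr0; exact: homFv_vpow.
  - exact: ex_class_cycle phiU phiV.
  - move=> a; have cv : vpow a * vpow v1 != 0 by rewrite -vpowD vpow_neq0.
    exact: ex_class_not_boundary cv.
move=> s /(nontorsion_degree_homotopy t02 hC)[x [hx cx tx]].
rewrite leNgt; apply/negP => s_gt.
(* The exponent 3 comes from v^3 d = ∂a. *)
apply: (tx (vexpD v1 (vexpD v1 v1))); rewrite !vpowD -expr2 -exprS.
(* The generators a, b, c have gr_t equal to -1, -3, -1. In degree above -1 their coefficients would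
   have positive degree, so they vanish. *)
have x0 i : gr_t (C := ex_complex) 1 i < s -> x 0 i = 0.
  by rewrite -subr_gt0 => /homFv_pos; apply.
apply: (ex_torsion phiU phiV) cx => [r|||].
- by rewrite expr2 -mulrA => /vpowM_eq0/vpowM_eq0.
- by apply: x0; rewrite gr_tE.
- by apply: x0; rewrite gr_tE /=; lra.
- by apply: x0; rewrite gr_tE.
Qed.

Unset Implicit Arguments.

Theorem proposition1p11 (R : realType) (C : cxFUV)
    (C_normalized : knot_like (modUV C))
    (C_given : homotopy_equivalent C ex_complex) :
  (exists t s : R, [/\ 0 <= t <= 2, upsilon_eq C t s & s != 0]) /\
  (forall j : nat, (0 < j)%N -> phi_eq (modUV C) j 0).
Proof.
split; last by move=> j _; exact: phi_eq_ex.
exists 1, (- 1); split; [by rewrite ler01 ler1n | exact: upsilon_ex | by rewrite oppr_eq0 oner_eq0].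
Qed.
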